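(* Let $k\ge1$. The generating function $\sum_{n\ge0}d_k(n)q^n$, where $d_k(n)=\sum_{\lambda\vdash n}\#\{s: h_{s,1}(\lambda)=k\}$ is the total number of first-column hooks of length $k$ over all partitions of $n$, equals $$\frac{q^k}{(q^k;q)_\infty}\sum_{l=1}^k\frac{1}{(q;q)_{k-l}} .$$
   Context: A partition $\lambda=(\lambda_1\ge\cdots\ge\lambda_t>0)$ has first-column hook lengths $h_{s,1}(\lambda)=\lambda_s+(t-s)$, $1\le s\le t$. Notation: $(a;q)_\infty=\prod_{j\ge0}(1-aq^j)$, $(q;q)_m=\prod_{j=1}^m(1-q^j)$. *)

(* Defs.v *)
From mathcomp Require Import all_boot all_order all_algebra.
Set Implicit Arguments. Unset Strict Implicit. Unset Printing Implicit Defensive.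
Import Order.TTheory GRing.Theory Num.Theory.
Local Open Scope ring_scope.

(** Partitions of n, encoded as weakly decreasing functions 'I_n -> 'I_n.+1
    (lambda_1 >= ... >= lambda_t > 0 padded with zeros to length n) with sum n.
    This is a bijection with the partitions of n. *)
Definition is_part (n : nat) (f : {ffun 'I_n -> 'I_n.+1}) : bool :=
  [forall i : 'I_n, forall j : 'I_n, (i <= j)%N ==> (f j <= f i)%N]
  && (\sum_(i < n) (f i : nat) == n)%N.

Definition plen (n : nat) (f : {ffun 'I_n -> 'I_n.+1}) : nat :=
  #|[set i : 'I_n | (0 < f i)%N]|.

(** first-column hook length h_{s,1} = lambda_s + (t - s), with s = i+1 *)
Definition hook1 (n : nat) (f : {ffun 'I_n -> 'I_n.+1}) (i : 'I_n) : nat :=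
  (f i + (plen f - i.+1))%N.

Definition nhooks (k n : nat) (f : {ffun 'I_n -> 'I_n.+1}) : nat :=
  #|[set i : 'I_n | (0 < f i)%N && (hook1 f i == k)]|.

Definition dk (k n : nat) : nat :=
  (\sum_(f : {ffun 'I_n -> 'I_n.+1} | is_part f) nhooks k f)%N.

Definition series := nat -> rat.

Definition ps_mul (f g : series) : series :=
  fun n => \sum_(i < n.+1) f i * g (n - i)%N.

Definition ps_of_poly (p : {poly rat}) : series := fun n => p`_n.

Definition ps_Xn (k : nat) : series := fun n => (n == k)%:R.

(** Multiplicative inverse of a series with nonzero constant term:
    g_0 = 1/f_0, g_n = -(1/f_0) * sum_{i=1}^n f_i g_{n-i}. *)
Fixpoint inv_seq (f : series) (n : nat) : seq rat :=
  match n with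
  | 0 => [:: (f 0%N)^-1]
  | m.+1 => let s := inv_seq f m in
            rcons s (- (f 0%N)^-1 * \sum_(i < m.+1) f i.+1 * nth 0 s (m - i)%N)
  end.

Definition ps_inv (f : series) : series := fun n => nth 0 (inv_seq f n) n.

Definition qpoch (m : nat) : {poly rat} := \prod_(1 <= j < m.+1) (1 - 'X^j).

(** (q^k;q)_infty = prod_{j>=0} (1 - q^(k+j)) as a formal power series (k >= 1):
    its n-th coefficient is that of the finite product over j <= n, since the
    remaining factors are 1 + O(q^(n+1)). *)
Definition qpoch_inf (k : nat) : series :=
  fun n => (\prod_(0 <= j < n.+1) (1 - 'X^(k + j)))`_n.

Definition rhs (k : nat) : series :=
  ps_mul (ps_mul (ps_Xn k) (ps_inv (qpoch_inf k)))
         (fun n => \sum_(1 <= l < k.+1) ps_inv (ps_of_poly (qpoch (k - l))) n).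

(* Main.v *)
(** Let D_b be the generating function counting hooks of length k over partitions
with parts at most b, and C_(b,m) that of partitions with m parts, all at most b.
If the largest part of a partition is b, removing it deletes exactly one
first-column hook, of length b + (number of remaining parts), and leaves the others
unchanged. Hence (1 - q^b) D_b = D_(b-1) + q^b C_(b,k-b), without the last term when
b > k. Since C_(b,m) = q^m (q;q)_(b+m-1) / ((q;q)_m (q;q)_(b-1)), telescoping up to
b = k gives (1 - q^k) D_k = q^k sum_(l = 1..k) 1 / (q;q)_(k-l), and each b > k only
contributes a further factor 1 / (1 - q^b). *)
Require Import Defs.
From HB Require Import structures.
From mathcomp Require Import all_boot all_order all_algebra.
From mathcomp Require Import ring zify.
From mathcomp Require Import boolp.
Set Implicit Arguments. Unset Strict Implicit. Unset Printing Implicit Defensive.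
Import GRing.Theory.
Local Open Scope ring_scope.

(** * Formal power series over the rationals as a commutative ring *)

Definition fps : Type := nat -> rat.

HB.instance Definition _ := gen_eqMixin fps.
HB.instance Definition _ := gen_choiceMixin fps.

Definition fps_add (f g : fps) : fps := fun n => f n + g n.
Definition fps_opp (f : fps) : fps := fun n => - f n.

Fact fps_addA : associative fps_add.
Proof. by move=> f g h; apply: funext => n; rewrite /fps_add addrA. Qed.
Fact fps_addC : commutative fps_add.
Proof. by move=> f g; apply: funext => n; rewrite /fps_add addrC. Qed.
Fact fps_add0 : left_id (fun=> 0) fps_add.
Proof. by move=> f; apply: funext => n; rewrite /fps_add add0r. Qed.
Fact fps_addN : left_inverse (fun=> 0) fps_opp fps_add.
Proof. by move=> f; apply: funext => n; rewrite /fps_add addNr. Qed.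

HB.instance Definition _ :=
  GRing.isZmodule.Build fps fps_addA fps_addC fps_add0 fps_addN.

Definition fps_trunc (n : nat) (f : fps) : {poly rat} := \poly_(i < n.+1) f i.

Lemma coef_fps_trunc n (f : fps) i : (i <= n)%N -> (fps_trunc n f)`_i = f i.
Proof. by move=> le_in; rewrite coef_poly ltnS le_in. Qed.

(* Truncation turns Cauchy products into polynomial products, from which
   commutativity and associativity are inherited. *)
Lemma ps_mul_trunc n (f g : fps) i :
  (i <= n)%N -> ps_mul f g i = (fps_trunc n f * fps_trunc n g)`_i.
Proof.
move=> le_in; rewrite coefM; apply: eq_bigr => j _.
by rewrite !coef_fps_trunc //; have := ltn_ord j; lia.
Qed.

(** Here p need not be the truncation of f: it may be a product of truncations, which is what
    associativity uses, or a monomial. *)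
Lemma ps_mul_truncl n (f g : fps) (p : {poly rat}) :
    (forall i, (i <= n)%N -> f i = p`_i) ->
  ps_mul f g n = (p * fps_trunc n g)`_n.
Proof.
move=> fp; rewrite coefM; apply: eq_bigr => j _.
by rewrite fp ?coef_fps_trunc //; have := ltn_ord j; lia.
Qed.

Fact ps_mulC : commutative (ps_mul : fps -> fps -> fps).
Proof.
by move=> f g; apply: funext => n; rewrite !(@ps_mul_trunc n) // mulrC.
Qed.

Fact ps_mulA : associative (ps_mul : fps -> fps -> fps).
Proof.
move=> f g h; apply: funext => n.
rewrite [ps_mul f _]ps_mulC.
rewrite (ps_mul_truncl _ (fun i => @ps_mul_trunc n g h i)).
rewrite (ps_mul_truncl _ (fun i => @ps_mul_trunc n f g i)).
by rewrite mulrC mulrA.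
Qed.

Fact ps_mul1 : left_id (ps_Xn 0) (ps_mul : fps -> fps -> fps).
Proof.
move=> f; apply: funext => n.
rewrite /ps_mul big_ord_recl /= subn0 mul1r big1 ?addr0 // => i _.
by rewrite /ps_Xn /= mul0r.
Qed.

Fact ps_mulDl : left_distributive (ps_mul : fps -> fps -> fps) +%R.
Proof.
move=> f g h; apply: funext => n.
rewrite [RHS]/GRing.add /= /fps_add /ps_mul -big_split /=.
by apply: eq_bigr => i _; rewrite -mulrDl.
Qed.

HB.instance Definition _ :=
  GRing.Zmodule_isComPzRing.Build fps ps_mulA ps_mulC ps_mul1 ps_mulDl.

Definition fps_of (p : {poly rat}) : fps := ps_of_poly p.
Definition fpsX (n : nat) : fps := ps_Xn n.

Lemma fps_eqP (f g : fps) : (forall n, f n = g n) -> f = g.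
Proof. exact: funext. Qed.

Lemma fps_ofM p q : fps_of (p * q) = fps_of p * fps_of q.
Proof. by apply: fps_eqP => n; rewrite /fps_of /ps_of_poly coefM. Qed.

Lemma fps_ofB p q : fps_of (p - q) = fps_of p - fps_of q.
Proof. by apply: fps_eqP => n; rewrite /fps_of /ps_of_poly coefB. Qed.

Lemma fps_of1 : fps_of 1 = 1.
Proof. by apply: fps_eqP => n; rewrite /fps_of /ps_of_poly coef1. Qed.

Lemma fps_ofXn n : fps_of 'X^n = fpsX n.
Proof. by apply: fps_eqP => i; rewrite /fps_of /ps_of_poly coefXn. Qed.

Lemma fpsXD m n : fpsX (m + n) = fpsX m * fpsX n.
Proof. by rewrite -!fps_ofXn exprD fps_ofM. Qed.

Lemma fpsX0 : fpsX 0 = 1. Proof. by []. Qed.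

Lemma coef_fpsXM m (f : fps) n :
  (fpsX m * f) n = if (m <= n)%N then f (n - m)%N else 0.
Proof.
rewrite -fps_ofXn [LHS](@ps_mul_truncl n _ _ 'X^m) // coefXnM.
by case: leqP => //= le_mn; rewrite coef_fps_trunc ?leq_subr.
Qed.

(** * Inverse series and finite q-Pochhammer symbols *)

Lemma size_inv_seq (f : series) n : size (inv_seq f n) = n.+1.
Proof. by elim: n => //= n IH; rewrite size_rcons IH. Qed.

(** Each stage only appends an entry, so earlier coefficients never change. *)
Lemma nth_inv_seq (f : series) n i :
  (i <= n)%N -> nth 0 (inv_seq f n) i = ps_inv f i.
Proof.
elim: n => [|n IH]; first by rewrite leqn0 => /eqP->.
rewrite leq_eqVlt => /orP[/eqP-> //|le_in] /=.
by rewrite nth_rcons size_inv_seq le_in IH.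
Qed.

Lemma ps_invS (f : series) n :
  ps_inv f n.+1 = - (f 0%N)^-1 * \sum_(i < n.+1) f i.+1 * ps_inv f (n - i)%N.
Proof.
rewrite {1}/ps_inv /= nth_rcons.
rewrite size_inv_seq ltnn eqxx; congr (_ * _); apply: eq_bigr => i _.
by rewrite nth_inv_seq ?leq_subr.
Qed.

Lemma mul_ps_inv (f : fps) : f 0%N != 0 -> f * (ps_inv f : fps) = 1.
Proof.
move=> f0; apply: fps_eqP => -[|n].
  by rewrite [LHS]/GRing.mul /= /ps_mul big_ord_recl big_ord0 /= addr0 divff.
rewrite [LHS]/GRing.mul /= /ps_mul big_ord_recl /= subn0 ps_invS.
by rewrite mulrA mulrN divff // mulN1r addNr.
Qed.

Lemma mulr_rinv_inj (R : comPzRingType) (a b x y : R) :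
  a * b = 1 -> a * x = a * y -> x = y.
Proof. by move=> ab /(congr1 ( *%R b)); rewrite !mulrA [b * a]mulrC ab !mul1r. Qed.

Definition fpoch (m : nat) : fps := fps_of (qpoch m).
Definition ifpoch (m : nat) : fps := ps_inv (ps_of_poly (qpoch m)).

Lemma qpochS m : qpoch m.+1 = qpoch m * (1 - 'X^(m.+1)).
Proof. by rewrite /qpoch big_nat_recr. Qed.

Lemma fpoch0 : fpoch 0 = 1.
Proof. by rewrite /fpoch /qpoch big_nil fps_of1. Qed.

Lemma fpochS m : fpoch m.+1 = fpoch m * (1 - fpsX m.+1).
Proof. by rewrite /fpoch qpochS fps_ofM fps_ofB fps_of1 fps_ofXn. Qed.

Lemma coef0_prod_1subXn (r : seq nat) :
  all (leq 1) r -> (\prod_(j <- r) (1 - 'X^j) : {poly rat})`_0 = 1.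
Proof.
elim: r => [|j r IH] /=; first by rewrite big_nil coef1.
case/andP=> j0 /IH r1; rewrite big_cons coef0M r1 mulr1 coefB coef1 coefXn.
by case: j j0 => //= j _; rewrite subr0.
Qed.

Lemma fpochK m : fpoch m * ifpoch m = 1.
Proof.
apply: mul_ps_inv.
rewrite /fpoch /fps_of /ps_of_poly /qpoch coef0_prod_1subXn ?oner_eq0 //.
by apply/allP => j; rewrite mem_index_iota => /andP[].
Qed.

(** * Partitions as lists with bounded parts *)

(* Partitions of n with parts at most b; n' - b' is n - b, written so that the
   termination checker accepts it. *)
Fixpoint parts (b : nat) : nat -> seq (seq nat) :=
  if b is b'.+1 then
    fix parts_b n :=
      parts b' n ++
      (if n is n'.+1 then
         if (b' <= n')%N then map (cons b) (parts_b (n' - b')%N) else [::]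
       else [::])
  else fun n => if n is 0 then [:: [::]] else [::].

Lemma partsS b n : parts b.+1 n = parts b n ++
  (if (b < n)%N then map (cons b.+1) (parts b.+1 (n - b.+1)) else [::]).
Proof. by case: n. Qed.

(** [path geq b s] combines weak decrease with the bound b on the parts. For each b the inner
    induction on n is strong, since removing a part [b.+1] keeps the bound and lowers the sum. *)
Lemma mem_parts b n s : s \in parts b n =
  [&& path geq b s, all (leq 1) s & sumn s == n].
Proof.
elim: b n s => [|b IHb] n s.
  case: s => [|x s]; first by case: n.
  by case: n x => [|n] [|x]; rewrite ?inE ?in_nil /= ?andbF.
elim/ltn_ind: n s => n IHn s; rewrite partsS mem_cat IHb.
case: s => [|x s].
  rewrite [X in _ || X](_ : _ = false) ?orbF //.
  by case: ifP => // _; apply/negP => /mapP[].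
have -> : (x :: s \in if (b < n)%N then [seq b.+1 :: i | i <- parts b.+1 (n - b.+1)]
    else [::]) = [&& (x == b.+1), (b < n)%N & s \in parts b.+1 (n - b.+1)].
  case: ltnP => _ /=; last by rewrite andbF.
  apply/mapP/andP => [[t t_in [-> ->]]|[/eqP-> s_in]]; first by rewrite eqxx.
  by exists s.
case: (ltnP b n) => [lt_bn|le_nb].
  rewrite IHn; last lia.
  rewrite /=; case: (x =P b.+1) => [->|ne_x].
    by rewrite /= ltnn leqnn /=; congr [&& _, _ & _]; apply/eqP/eqP; lia.
  by rewrite orbF; congr [&& _ && _, _ & _]; rewrite /geq /=; lia.
(* Now n is at most b, so a head [b.+1] already exceeds the required sum. *)
rewrite andbF orbF /=; have [->|ne_x] := eqVneq x b.+1.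
  by rewrite /= ltnn /=; apply/esym/negbTE/negP => /and3P[_ _ /eqP]; lia.
by congr [&& _ && _, _ & _]; rewrite /geq /=; lia.
Qed.

Lemma parts_uniq b n : uniq (parts b n).
Proof.
elim: b n => [|b IHb] n; first by case: n.
elim/ltn_ind: n => n IHn; rewrite partsS.
case: ltnP => [lt_bn|_]; last by rewrite cats0.
rewrite cat_uniq IHb map_inj_uniq; last by move=> ? ? [].
rewrite IHn ?andbT; last lia.
(* The two halves are disjoint: a head [b.+1] violates the bound b. *)
apply/hasPn => _ /mapP[t _ ->]; rewrite mem_parts /=.
by rewrite ltnn.
Qed.

(** The tail consists of the t - s parts after the head, so the summand tests the head's
    first-column hook length. *)
Fixpoint hooks (k : nat) (s : seq nat) : nat :=
  if s is x :: s' then ((x + size s' == k) + hooks k s')%N else 0%N.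

(* C_(b,m) of the header; [hooks_fps] below is D_b. *)
Definition length_fps (b m : nat) : fps :=
  fun n => (count (fun s => size s == m) (parts b n))%:R.

Definition hooks_total (k b n : nat) : nat := (\sum_(s <- parts b n) hooks k s)%N.

Definition hooks_fps (k b : nat) : fps := fun n => (hooks_total k b n)%:R.

(** * Recurrences in the largest part and their solutions *)

Lemma length_fps0 m : length_fps 0 m = (m == 0%N)%:R.
Proof.
by apply: fps_eqP => -[|n]; case: m.
Qed.

Lemma length_fps_b0 b : length_fps b 0 = 1.
Proof.
elim: b => [|b IH]; first exact: length_fps0.
rewrite -IH; apply: fps_eqP => n; rewrite /length_fps partsS count_cat.
case: ifP => _; rewrite ?count_map /= ?addn0 //.
by rewrite [X in (_ + X)%N](eq_count (a2 := pred0)) ?count_pred0 ?addn0.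
Qed.

Lemma length_fpsS b m : length_fps b.+1 m.+1 = length_fps b m.+1 + fpsX b.+1 * length_fps b.+1 m.
Proof.
apply: fps_eqP => n; rewrite [RHS]/GRing.add /= /fps_add coef_fpsXM.
rewrite {1}/length_fps partsS count_cat natrD; congr (_ + _).
by case: ifP => // _; rewrite count_map; congr (_%:R); apply: eq_count.
Qed.

(** A new head [b.+1] has hook length k exactly when the tail has k - (b+1) parts. The test [b < k]
    matters: for larger b truncated subtraction would wrongly count the empty tail. *)
Lemma hooks_fpsS k b : hooks_fps k b.+1 = hooks_fps k b + fpsX b.+1 *
  (hooks_fps k b.+1 + if (b < k)%N then length_fps b.+1 (k - b.+1) else 0).
Proof.
apply: fps_eqP => n; rewrite [RHS]/GRing.add /= /fps_add coef_fpsXM.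
rewrite {1}/hooks_fps /hooks_total partsS big_cat natrD; congr (_ + _).
case: ifP => [_|_]; last by rewrite big_nil.
rewrite big_map /= big_split /= natrD addrC; congr (_ + _).
case: ltnP => [lt_bk|le_kb].
  rewrite /length_fps; congr (_%:R).
  rewrite -sum1_count [RHS]big_mkcond /=; apply: eq_bigr => s _.
  by have -> : (b.+1 + size s == k) = (size s == k - b.+1)%N by lia.
by rewrite big1 // => s _; case: eqP => //; lia.
Qed.

(** With denominators cleared, this says that C_(b+1,m) is q^m times the Gaussian binomial of b + m
    over m. It follows by double induction from [length_fpsS]. *)
Lemma length_fps_fpoch b m : length_fps b.+1 m * (fpoch m * fpoch b) = fpsX m * fpoch (b + m).
Proof.
elim: b m => [|b IHb] m.
  elim: m => [|m IHm]; first by rewrite length_fps_b0 fpoch0 fpsX0 !mul1r.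
  rewrite !fpoch0 !mulr1 !add0n in IHm *.
  have -> : length_fps 1 m.+1 = fpsX 1 * length_fps 1 m by rewrite length_fpsS length_fps0 add0r.
  rewrite fpochS.
  have -> : fpsX 1 * length_fps 1 m * (fpoch m * (1 - fpsX m.+1)) =
    fpsX 1 * (length_fps 1 m * fpoch m) * (1 - fpsX m.+1) by ring.
  by rewrite IHm -(add1n m) fpsXD; ring.
elim: m => [|m IHm]; first by rewrite length_fps_b0 fpoch0 fpsX0 addn0 !mul1r.
rewrite length_fpsS mulrDl.
have E1 : length_fps b.+1 m.+1 * (fpoch m.+1 * fpoch b.+1)
   = (1 - fpsX b.+1) * (fpsX m.+1 * fpoch (b + m.+1)).
  by rewrite -IHb [fpoch b.+1]fpochS; ring.
have E2 : fpsX b.+2 * length_fps b.+2 m * (fpoch m.+1 * fpoch b.+1)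
   = fpsX b.+2 * (1 - fpsX m.+1) * (fpsX m * fpoch (b.+1 + m)).
  by rewrite -IHm [fpoch m.+1]fpochS; ring.
have Ep : fpoch (b.+1 + m.+1) = fpoch (b + m.+1) * (1 - fpsX b.+1 * fpsX m.+1).
  by rewrite addSn fpochS -addSn fpsXD.
(* Up to the common factor (q;q)_(b+m+1) this is the q-Pascal identity (1 - q^(b+1)) q^(m+1) +
   q^(b+2) (1 - q^(m+1)) q^m = q^(m+1) (1 - q^(b+m+2)). *)
rewrite E1 E2 Ep addSnnS -(add1n b.+1) -(add1n m) !fpsXD; ring.
Qed.

Lemma hooks_fps0 k : hooks_fps k 0 = 0.
Proof.
apply: fps_eqP => -[|n]; rewrite /hooks_fps /hooks_total /= ?big_nil //.
by rewrite big_seq1.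
Qed.

(** Multiplying the recurrence for D_(b+1) by (q;q)_b makes it telescope; passing from b to b + 1
    adds the summand l = b + 1. *)
Lemma hooks_fps_fpoch k b : (b <= k)%N -> fpoch b * hooks_fps k b =
  fpsX k * fpoch k.-1 * \sum_(1 <= l < b.+1) ifpoch (k - l).
Proof.
elim: b => [_|b IHb lt_bk]; first by rewrite hooks_fps0 big_geq // !mulr0.
have E : (1 - fpsX b.+1) * hooks_fps k b.+1 =
    hooks_fps k b + fpsX b.+1 * length_fps b.+1 (k - b.+1).
  by apply/eqP; rewrite mulrBl mul1r subr_eq [eqbLHS]hooks_fpsS lt_bk; apply/eqP; ring.
rewrite fpochS -mulrA E mulrDr IHb 1?ltnW // [in RHS]big_nat_recr //= [RHS]mulrDr.
congr (_ + _); set m := (k - b.+1)%N.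
apply: (mulr_rinv_inj (fpochK m)).
have -> : fpoch m * (fpsX k * fpoch k.-1 * ifpoch m) =
   fpsX k * fpoch k.-1 * (fpoch m * ifpoch m) by ring.
rewrite fpochK mulr1.
have -> : fpoch m * (fpoch b * (fpsX b.+1 * length_fps b.+1 m)) =
  fpsX b.+1 * (length_fps b.+1 m * (fpoch m * fpoch b)) by ring.
(* Since m = k - (b+1), the exponent b + 1 + m is k and the index b + m is k - 1. *)
rewrite length_fps_fpoch mulrA -fpsXD; congr (fpsX _ * fpoch _); rewrite /m; lia.
Qed.

Lemma hooks_fps_large k b : (0 < k)%N ->
  fps_of (\prod_(0 <= j < b.+1) (1 - 'X^(k + j))) * hooks_fps k (k + b) =
  fpsX k * \sum_(1 <= l < k.+1) ifpoch (k - l).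
Proof.
move=> k0; elim: b => [|b IHb].
  (* Cancelling (q;q)_(k-1) turns the factor (q;q)_k of D_k into 1 - q^k. *)
  rewrite big_nat1 addn0; apply: (mulr_rinv_inj (fpochK k.-1)).
  rewrite mulrA fps_ofB fps_of1 fps_ofXn -{2}(prednK k0) -fpochS prednK //.
  by rewrite hooks_fps_fpoch //; ring.
rewrite big_nat_recr //= fps_ofM -IHb -mulrA; congr (_ * _).
rewrite fps_ofB fps_of1 fps_ofXn mulrBl mul1r addnS {1}hooks_fpsS.
by rewrite ltnNge leq_addr addr0; ring.
Qed.

(** * Removing the bound on the parts, coefficient by coefficient *)

Lemma hooks_fps_stable k b n : (n <= b)%N -> hooks_fps k b n = hooks_fps k n n.
Proof.
move=> le_nb; rewrite -(subnKC le_nb); elim: (b - n)%N => [|j IHj].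
  by rewrite addn0.
by rewrite addnS /hooks_fps /hooks_total partsS ltnNge leq_addr cats0.
Qed.

(** A factor with j > n has exponent k + j > n, so it leaves coefficient n unchanged. *)
Lemma qpoch_inf_stable k b n : (n <= b)%N ->
  (\prod_(0 <= j < b.+1) (1 - 'X^(k + j)))`_n = qpoch_inf k n.
Proof.
move=> le_nb; rewrite -(subnKC le_nb); elim: (b - n)%N => [|j IHj].
  by rewrite addn0.
rewrite addnS big_nat_recr //= mulrBr mulr1 coefB IHj coefMXn ifT ?subr0 //.
lia.
Qed.

Lemma hooks_fps_qpoch_inf k : (0 < k)%N ->
  (qpoch_inf k : fps) * (fun n => hooks_fps k n n) =
  fpsX k * \sum_(1 <= l < k.+1) ifpoch (k - l).
Proof.
(* Coefficient n of the product involves only coefficients up to n of each factor, and these are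
   stable at b = n. *)
move=> k0; apply: fps_eqP => n; rewrite -(hooks_fps_large n k0).
apply: eq_bigr => i _; have := ltn_ord i => lt_in; congr (_ * _).
  by rewrite -(@qpoch_inf_stable k n).
by rewrite [RHS]hooks_fps_stable //; lia.
Qed.

(** * Comparison with partitions encoded as finite functions *)

Lemma nth_filter_pos (t : seq nat) i : sorted geq t ->
  nth 0%N (filter (leq 1) t) i = nth 0%N t i.
Proof.
elim: t i => //= x t IHt i xt.
have /IHt{}IHt := path_sorted xt.
case: x xt => [|x] xt /=; last by case: i => //= i; exact: IHt.
(* After a zero head every entry is zero, so filtering removes only a suffix, and the default 0 of
   [nth] stands in for it. *)
have t0 : all (pred1 0%N) t.
  apply: sub_all (order_path_min _ xt); first by move=> y; rewrite /geq /= leqn0.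
  by move=> a b c; rewrite /geq /=; lia.
have -> : filter (leq 1) t = [::].
  apply/eqP; rewrite -(negbK (_ == _)) -has_filter -all_predC.
  by apply: sub_all t0 => y /= /eqP->.
have -> : 0%N :: t = nseq (size t).+1 0%N by rewrite /= -(all_pred1P _ _ t0).
by rewrite nth_nil nth_nseq if_same.
Qed.

Section FfunParts.
Variable n : nat.
Implicit Type f : {ffun 'I_n -> 'I_n.+1}.

Definition values f : seq nat := [seq (f i : nat) | i <- enum 'I_n].
Definition part_seq f : seq nat := filter (leq 1) (values f).

Lemma nth_values f (i : 'I_n) : nth 0%N (values f) i = f i.
Proof. by rewrite (nth_map i) ?size_enum_ord // nth_ord_enum. Qed.

Lemma size_values f : size (values f) = n.
Proof. by rewrite size_map size_enum_ord. Qed.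

Lemma sumn_values f : sumn (values f) = (\sum_(i < n) (f i : nat))%N.
Proof. by rewrite sumnE big_map big_enum. Qed.

Lemma sorted_values f :
  sorted geq (values f) = [forall i : 'I_n, forall j : 'I_n, (i <= j)%N ==> (f j <= f i)%N].
Proof.
have tr : transitive geq by move=> a b c; rewrite /geq /=; lia.
have rf : reflexive geq by move=> a; rewrite /geq /=.
apply/idP/forallP => [st i|H].
  apply/forallP => j; apply/implyP => le_ij.
  rewrite -!nth_values; apply: (sorted_leq_nth tr rf 0%N st i j _ _ le_ij);
    by rewrite inE size_values.
apply/(sortedP 0%N) => i; rewrite size_values => lt_in.
have /forallP/(_ (Ordinal lt_in))/implyP/(_ (leqnSn i)) := H (Ordinal (ltnW lt_in)).
by rewrite -!nth_values.
Qed.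

Lemma sumn_filter_pos (t : seq nat) : sumn (filter (leq 1) t) = sumn t.
Proof. by elim: t => //= -[|x] t IH /=; rewrite IH. Qed.

Lemma is_partE f : is_part f = sorted geq (values f) && (sumn (values f) == n).
Proof. by rewrite /is_part sorted_values sumn_values. Qed.

Lemma nth_part_seq f (i : 'I_n) : is_part f -> nth 0%N (part_seq f) i = f i.
Proof. by rewrite is_partE => /andP[st _]; rewrite nth_filter_pos // nth_values. Qed.

Lemma size_part_seq f : size (part_seq f) = plen f.
Proof.
rewrite size_filter count_map /plen cardsE cardE size_filter.
by rewrite enumT; apply: eq_count.
Qed.

Lemma size_le_sumn (s : seq nat) : all (leq 1) s -> (size s <= sumn s)%N.
Proof. by elim: s => //= x s IH /andP[x0 /IH]; lia. Qed.

(** Both lists are duplicate-free with the same members: padding with zeros inverts [part_seq], and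
    [nth] with default 0 recovers f. *)
Lemma part_seq_perm :
  perm_eq [seq part_seq f | f <- enum [pred f : {ffun 'I_n -> 'I_n.+1} | is_part f]] (parts n n).
Proof.
apply: uniq_perm; last 1 first.
- move=> s; rewrite mem_parts; apply/mapP/and3P => [[f]|[ns s1 /eqP sn]].
    rewrite mem_enum inE => fP ->; move: (fP); rewrite is_partE => /andP[st /eqP sv].
    rewrite /part_seq filter_all sumn_filter_pos sv; split=> //.
    have tr : transitive geq by move=> a b c; rewrite /geq /=; lia.
    rewrite path_sortedE //; rewrite sorted_filter // andbT.
    rewrite all_filter; apply/allP => x /mapP[i _ ->]; apply/implyP => _.
    by rewrite /geq /= -ltnS.
  have szs : (size s <= n)%N by rewrite -sn size_le_sumn.
  (* The default 0 supplies the padding; [inord] is faithful because [les] bounds every part by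
     n. *)
  pose f := [ffun i : 'I_n => inord (nth 0%N s i) : 'I_n.+1].
  have les i : (nth 0%N s i <= n)%N.
    have [lt_is|/(nth_default 0%N)-> //] := ltnP i (size s).
    move: ns; rewrite path_sortedE; last by move=> a b c; rewrite /geq /=; lia.
    by case/andP => /(all_nthP 0%N)/(_ i lt_is).
  have vE : values f = s ++ nseq (n - size s) 0%N.
    apply: (@eq_from_nth _ 0%N); first by rewrite size_values size_cat size_nseq subnKC.
    move=> i; rewrite size_values => lt_in.
    rewrite (nth_values f (Ordinal lt_in)) ffunE inordK ?ltnS //=.
    rewrite nth_cat; case: ltnP => // le_si.
    by rewrite nth_nseq if_same nth_default.
  exists f; last first.
    have nseq0 j : filter (leq 1) (nseq j 0%N) = [::] by elim: j.
    by rewrite /part_seq vE filter_cat nseq0 cats0; apply/esym/all_filterP.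
  rewrite mem_enum inE is_partE vE sumn_cat sumn_nseq mul0n addn0 sn eqxx andbT.
  (* Appending any number j of zeros preserves weak decrease, by induction on s. *)
  move: (n - size s)%N (path_sorted ns) => j.
  elim: (s) => [|x [|y t] IH] /=; [by elim: j => // -[] | by case: j IH | ].
  by case/andP=> -> /IH.
- rewrite map_inj_in_uniq ?enum_uniq // => f g; rewrite !mem_enum !inE => fP gP fg.
  by apply/ffunP => i; apply: val_inj; rewrite /= -(nth_part_seq i fP) fg nth_part_seq.
- exact: parts_uniq.
Qed.

Lemma hooksE k (s : seq nat) :
  hooks k s = (\sum_(i < size s) (nth 0%N s i + (size s - i.+1) == k))%N.
Proof.
elim: s => [|x s IH] /=; first by rewrite big_ord0.
by rewrite big_ord_recl /= subSS subn0 IH.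
Qed.

Lemma nhooksE k f : is_part f -> nhooks k f = hooks k (part_seq f).
Proof.
move=> fP; rewrite hooksE /nhooks cardsE -sum1_card big_mkcond /=.
have le_sn : (size (part_seq f) <= n)%N.
  by rewrite -[X in (_ <= X)%N](size_values f) size_filter count_size.
rewrite (big_ord_widen n (fun i => nat_of_bool
  (nth 0%N (part_seq f) i + (size (part_seq f) - i.+1) == k)%N) le_sn).
rewrite [RHS]big_mkcond /=; apply: eq_bigr => i _.
rewrite unfold_in /= /hook1 -size_part_seq nth_part_seq //.
(* The positive entries of f are exactly those at indices below the length of [part_seq f], which
   matches the condition of the widened sum. *)
have -> : (0 < f i)%N = (i < size (part_seq f))%N.
  rewrite -(nth_part_seq i fP); case: (ltnP i) => [lt_i|/(nth_default 0%N)->] //.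
  by have /(all_nthP 0%N)/(_ i lt_i) := filter_all (leq 1) (values f).
by case: (_ < _)%N => //=; case: (_ == _).
Qed.

Lemma dkE k : dk k n = hooks_total k n n.
Proof.
rewrite /hooks_total -(perm_big _ part_seq_perm) /= big_map big_enum /=.
by apply: eq_bigr => f; exact: nhooksE.
Qed.

End FfunParts.

Lemma fps_sumE (I : Type) (r : seq I) (F : I -> fps) n :
  (\sum_(i <- r) F i) n = \sum_(i <- r) F i n.
Proof. by elim: r => [|i r IH]; rewrite ?big_nil // !big_cons -IH. Qed.

Theorem theorem4p3 (k : nat) : (0 < k)%N ->
  (fun n : nat => ((dk k n)%:R : rat)) = rhs k.
Proof.
move=> k0.
have dkD : (fun n : nat => ((dk k n)%:R : rat)) = fun n => hooks_fps k n n.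
  by apply: funext => n; rewrite dkE.
have -> : rhs k = fpsX k * ps_inv (qpoch_inf k) * \sum_(1 <= l < k.+1) ifpoch (k - l).
  rewrite /rhs; congr (ps_mul _ _); apply: funext => n.
  by rewrite fps_sumE.
have qK : (qpoch_inf k : fps) * ps_inv (qpoch_inf k) = 1.
  (* Coefficient 0 comes from the single factor 1 - q^k, whose constant term is 1 because k is
     positive. *)
  apply: mul_ps_inv; rewrite /qpoch_inf big_nat1 addn0 coefB coef1 coefXn.
  by case: (k) k0.
rewrite dkD; apply: (mulr_rinv_inj qK).
by rewrite hooks_fps_qpoch_inf // [RHS]mulrA [X in _ = X * _]mulrCA qK mulr1.
Qed.
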